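(* There exists an absolute constant $C > 0$ such that the following holds. Let $R$ be a ring, and let $A \subset R$ be finite and non-empty. Suppose that $|A \cdot A - A \cdot A| \leq K |A|$ and $|A \cdot A| \geq |A|/K$ for some $K \geq 1$. Then at least one of the following holds: (i) ($A-A$ has many zero divisors) $|(A-A) \setminus R^*| \geq C^{-1} K^{-C} |A|$; or (ii) (Ring structure in a Freiman model) there exist a finite ring $R_0$ of cardinality between $|A|$ and $CK^C |A|$, an outer automorphism $\phi: R_0 \to R_0$ of that ring, and, for every $n \geq 1$, an embedding (injective map) $\iota_n: \langle A^n \rangle \to R_0 \cdot t^n$ from the additive group $\langle A^n \rangle$ generated by the $n$-fold product set $A^n$ to the degree $n$ component $R_0 \cdot t^n$ of the twisted polynomial ring $R_0[t]_\phi$, such that each $\iota_n$ is an additive homomorphism, and such that $\iota_n(g_n)\, \iota_m(g_m) = \iota_{n+m}(g_n g_m)$ for all $n,m \geq 1$ and all $g_n \in \langle A^n \rangle$ and $g_m \in \langle A^m \rangle$.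
   Context: Rings are associative, but need not be commutative and need not contain a multiplicative identity. For subsets $A,B$ of a ring $R$: $A-B := \{a-b : a \in A, b\in B\}$, $A\cdot B := \{ab : a\in A, b\in B\}$, and $A^n := A\cdot \ldots \cdot A$ ($n$ factors) is the set of all products $a_1\cdots a_n$ with $a_i\in A$. $\langle A^n\rangle$ is the additive subgroup of $R$ generated by $A^n$. $|A|$ denotes the cardinality of a finite set $A$. $R^*$ denotes the set of non-zero-divisors of $R$, i.e. the elements $r \in R$ such that $ra \neq 0$ and $ar \neq 0$ whenever $a \in R$, $a \neq 0$. An ''outer automorphism'' $\phi$ of a ring $R_0$ here just means a ring automorphism $\phi: R_0\to R_0$ (not required to be inner). The twisted polynomial ring $R_0[t]_\phi$ is the ring generated by $R_0$ and a formal variable $t$ subject to the relations $ta = \phi(a)t$ for $a\in R_0$; concretely, it consists of formal sums $\sum_{n=0}^d a_n t^n$ with $a_n \in R_0$, $d \ge 0$, added coefficientwise and multiplied via $(a t^n)(b t^m) = a\,\phi^n(b)\, t^{n+m}$. Its degree $n$ component is $R_0\cdot t^n = \{ a t^n : a \in R_0\}$. *)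

(* Defs.v *)
From HB Require Import structures.
From mathcomp Require Import all_boot all_order all_algebra.
From mathcomp Require Import finmap monalg.
From mathcomp Require Import boolp classical_sets reals exp.

Set Implicit Arguments.
Unset Strict Implicit.
Unset Printing Implicit Defensive.

Import GRing.Theory.

Local Open Scope fset_scope.
Local Open Scope ring_scope.

(* Associative rings, possibly noncommutative, possibly trivial, without a
   distinguished identity (every ring structure of MathComp carries a 1). *)
HB.mixin Record Zmodule_isRng R of GRing.Zmodule R := {
  rmul : R -> R -> R;
  rmulA : associative rmul;
  rmulDl : left_distributive rmul +%R;
  rmulDr : right_distributive rmul +%R;
}.

#[short(type="rngType")]
HB.structure Definition Rng := {R of GRing.Zmodule R & Zmodule_isRng R}.

#[short(type="finRngType")]
HB.structure Definition FinRng := {R of Rng R & Finite R}.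

Notation "x ** y" := (rmul x y)
  (at level 40, left associativity) : ring_scope.

Section RngTheory.
Variable R : rngType.
Implicit Types x y : R.

Lemma rmul0r x : 0 ** x = 0.
Proof. by apply: (addIr (0 ** x)); rewrite -rmulDl !add0r. Qed.

Lemma rmulr0 x : x ** 0 = 0.
Proof. by apply: (addIr (x ** 0)); rewrite -rmulDr !add0r. Qed.

Definition nonzerodiv (r : R) : Prop :=
  forall a : R, a != 0 -> r ** a != 0 /\ a ** r != 0.

Definition diffset (A B : {fset R}) : {fset R} :=
  [fset a - b | a in A, b in B].

Definition prodset (A B : {fset R}) : {fset R} :=
  [fset a ** b | a in A, b in B].

(* [prodpow A n] is A^n for n >= 1; the value at 0, where A^0 has no meaning in
   the absence of an identity, is junk. *)
Definition prodpow (A : {fset R}) (n : nat) : {fset R} :=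
  iter n.-1 (prodset ^~ A) A.

Definition is_addsubgroup (H : set R) : Prop :=
  H 0 /\ forall x y, H x -> H y -> H (x - y).

Definition addspan (A : {fset R}) : set R :=
  smallest is_addsubgroup [set` A].

End RngTheory.

Record rngAut (R : rngType) := RngAut {
  rngaut_fun :> R -> R;
  rngautD : {morph rngaut_fun : x y / x + y};
  rngautM : {morph rngaut_fun : x y / x ** y};
  rngaut_bij : bijective rngaut_fun
}.

(* The twisted polynomial ring R[t]_phi: finitely supported families of
   coefficients indexed by nat, where << a *g n >> is a t^n. *)
Definition twpoly (R : rngType) (phi : rngAut R) : Type := {malg R[nat]}.

HB.instance Definition _ (R : rngType) (phi : rngAut R) :=
  GRing.Zmodule.on (twpoly phi).

Section TwistedPoly.
Variables (R : rngType) (phi : rngAut R).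

Definition twmono (a : R) (n : nat) : twpoly phi := << a *g n >>.

Definition twmul (p q : twpoly phi) : twpoly phi :=
  \sum_(i <- msupp p) \sum_(j <- msupp q)
    twmono (p@_i ** iter i phi q@_j) (i + j)%N.

Definition twdeg (n : nat) : set (twpoly phi) :=
  [set p | exists a : R, p = twmono a n].

Lemma iter_rngautD n : {morph iter n phi : x y / x + y}.
Proof. by elim: n => [|n IHn] x y //=; rewrite IHn rngautD. Qed.

Lemma iter_rngautM n : {morph iter n phi : x y / x ** y}.
Proof. by elim: n => [|n IHn] x y //=; rewrite IHn rngautM. Qed.

Lemma iter_rngaut0 n : iter n phi 0 = 0.
Proof. by apply: (addIr (iter n phi 0)); rewrite -iter_rngautD !add0r. Qed.

Lemma twmonoD n : {morph twmono^~ n : a b / a + b}.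
Proof. by move=> a b; rewrite /twmono monalgUD. Qed.

Lemma twmono0 n : twmono 0 n = 0.
Proof. by rewrite /twmono monalgU0. Qed.

Lemma twmulEw (d1 d2 : {fset nat}) (p q : twpoly phi) :
  msupp p `<=` d1 -> msupp q `<=` d2 ->
  twmul p q = \sum_(i <- d1) \sum_(j <- d2)
                twmono (p@_i ** iter i phi q@_j) (i + j)%N.
Proof.
move=> le1 le2; rewrite /twmul (big_fset_incl _ le1) /=; last first.
  move=> i _ /mcoeff_outdom pi0; rewrite big1 // => j _.
  by rewrite pi0 rmul0r twmono0.
apply: eq_bigr => i _; apply: (big_fset_incl _ le2) => j _ /mcoeff_outdom qj0.
by rewrite qj0 iter_rngaut0 rmulr0 twmono0.
Qed.

Lemma twmulDl : left_distributive twmul +%R.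
Proof.
move=> p q r; pose d := msupp p `|` msupp q `|` msupp (p + q).
have le1 : msupp p `<=` d by rewrite /d -fsetUA fsubsetUl.
have le2 : msupp q `<=` d by rewrite /d -fsetUA fsetUCA fsubsetUl.
rewrite !(@twmulEw d (msupp r)) ?fsubset_refl ?fsubsetUr //.
rewrite -big_split; apply: eq_bigr => i _ /=.
rewrite -big_split; apply: eq_bigr => j _ /=.
by rewrite mcoeffD rmulDl twmonoD.
Qed.

Lemma twmulDr : right_distributive twmul +%R.
Proof.
move=> r p q; pose d := msupp p `|` msupp q `|` msupp (p + q).
have le1 : msupp p `<=` d by rewrite /d -fsetUA fsubsetUl.
have le2 : msupp q `<=` d by rewrite /d -fsetUA fsetUCA fsubsetUl.
rewrite !(@twmulEw (msupp r) d) ?fsubset_refl ?fsubsetUr //.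
rewrite -big_split; apply: eq_bigr => i _ /=.
rewrite -big_split; apply: eq_bigr => j _ /=.
by rewrite mcoeffD iter_rngautD rmulDr twmonoD.
Qed.

Lemma twmul0 p : twmul p 0 = 0.
Proof. by apply: (addIr (twmul p 0)); rewrite -twmulDr !add0r. Qed.

Lemma tw0mul p : twmul 0 p = 0.
Proof. by apply: (addIr (twmul 0 p)); rewrite -twmulDl !add0r. Qed.

Lemma twmul_suml (I : Type) (s : seq I) (F : I -> twpoly phi) q :
  twmul (\sum_(i <- s) F i) q = \sum_(i <- s) twmul (F i) q.
Proof. exact: (big_morph (twmul^~ q) (fun p r => twmulDl p r q) (tw0mul q)). Qed.

Lemma twmul_sumr (I : Type) (s : seq I) (F : I -> twpoly phi) q :
  twmul q (\sum_(i <- s) F i) = \sum_(i <- s) twmul q (F i).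
Proof. exact: (big_morph (twmul q) (twmulDr q) (twmul0 q)). Qed.

Lemma twmulUU a n b m :
  twmul (twmono a n) (twmono b m) = twmono (a ** iter n phi b) (n + m)%N.
Proof.
rewrite (twmulEw (msuppU_le (k := n)) (msuppU_le (k := m))).
by rewrite !big_seq_fset1 !mcoeffUU.
Qed.

Lemma twpolyE (p : twpoly phi) : p = \sum_(i <- msupp p) twmono p@_i i.
Proof. exact: monalgE. Qed.

Lemma twmulA : associative twmul.
Proof.
move=> p q r; rewrite (twpolyE p) !twmul_suml; apply: eq_bigr => i _.
rewrite (twpolyE q) twmul_suml !twmul_sumr twmul_suml.
apply: eq_bigr => j _; rewrite (twpolyE r) !twmul_sumr.
by apply: eq_bigr => k _; rewrite !twmulUU iter_rngautM rmulA addnA iterD.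
Qed.

HB.instance Definition _ :=
  Zmodule_isRng.Build (twpoly phi) twmulA twmulDl twmulDr.

End TwistedPoly.

Arguments twdeg {R} phi n _.

(* Main.v *)
Require Import Defs.
From HB Require Import structures.
From mathcomp Require Import all_boot all_order all_algebra.
From mathcomp Require Import fingroup perm.
From mathcomp Require Import finmap monalg.
From mathcomp Require Import boolp classical_sets cardinality reals exp.
From mathcomp Require Import lra zify.

(* Fix e in A - A that is not a zero divisor, put B = AA - AA, and call r near p
   when |pA + rA| <= K^O(1) |A|.  If p is not a zero divisor, counting collisions
   pa + rb = pa' + rb' and discarding those where b - b' is a zero divisor yields
   r(b - b') = p(a' - a) with b - b' cancellable.  By the Plunnecke-Ruzsa
   inequalities, B is covered by K^O(1) translates of (b - b')(A - A); this bounds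
   |pB + rB| by a fixed power of K times |A|, whatever power was used to define
   nearness.  Hence the elements near p form a group, and elements near p
   multiplied by A are near pe; so all of <A^n> is near e^n.  Each collision
   determines r, so at most K^O(1) |A| elements are near e^n.

   Thus the groups H_n = <A^n> have bounded size, and multiplication by e on
   either side is an injection H_n -> H_{n+1} which is bijective for large n.
   Inverting e in the graded ring they form gives R0 = union of the H_n e^-n, with
   phi the conjugation by e and iota_n(g) = (g e^-n) t^n. *)

Set Implicit Arguments.
Unset Strict Implicit.
Unset Printing Implicit Defensive.

Import Order.TTheory GRing.Theory Num.Theory.

Local Open Scope fset_scope.
Local Open Scope ring_scope.

(** * Sumsets *)

Section Sumset.
Variable V : zmodType.
Implicit Types (A B C D X Y Z T : {fset V}) (a : V).

Definition sumset A B : {fset V} := [fset a + b | a in A, b in B].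
Definition oppset A : {fset V} := [fset - a | a in A].

Local Infix "+:" := sumset (at level 50, left associativity).

Lemma sumsetP A B x :
  reflect (exists2 a, a \in A & exists2 b, b \in B & x = a + b) (x \in A +: B).
Proof. exact: imfset2P. Qed.

Lemma mem_sumset A B x y : x \in A -> y \in B -> x + y \in A +: B.
Proof. by move=> xA yB; apply/sumsetP; exists x => //; exists y. Qed.

Lemma mem_oppset A x : (x \in (oppset A)) = (- x \in A).
Proof.
apply/imfsetP/idP => [[y yA ->]|xA]; first by rewrite opprK.
by exists (- x); rewrite ?opprK.
Qed.

Lemma oppsetK A : oppset (oppset A) = A.
Proof. by apply/fsetP => x; rewrite !mem_oppset opprK. Qed.

Lemma sumsetC A B : A +: B = B +: A.
Proof.
by apply/fsetP => x; apply/sumsetP/sumsetP => -[y ? [z ? ->]];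
  exists z => //; exists y; rewrite // addrC.
Qed.

Lemma sumsetA A B C : A +: (B +: C) = A +: B +: C.
Proof.
apply/fsetP => x; apply/sumsetP/sumsetP => -[].
  move=> a aA [_ /sumsetP[b bB [c cC ->]] ->].
  by exists (a + b); [exact: mem_sumset | exists c; rewrite // addrA].
move=> _ /sumsetP[a aA [b bB ->]] [c cC ->].
by exists a => //; exists (b + c); [exact: mem_sumset | rewrite addrA].
Qed.

Lemma sumsetAC A B C : A +: B +: C = A +: C +: B.
Proof. by rewrite -!sumsetA (sumsetC B). Qed.

Lemma sumsetCA A B C : A +: (B +: C) = B +: (A +: C).
Proof. by rewrite !sumsetA (sumsetC A). Qed.

Lemma sumsetACA A B C D : A +: B +: (C +: D) = A +: C +: (B +: D).
Proof. by rewrite !sumsetA (sumsetAC A). Qed.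

Lemma sumsetS A A' B B' : A `<=` A' -> B `<=` B' -> A +: B `<=` A' +: B'.
Proof.
move=> /fsubsetP sA /fsubsetP sB; apply/fsubsetP => _ /sumsetP[a aA [b bB ->]].
by rewrite mem_sumset ?sA ?sB.
Qed.

Lemma oppsetD A B : oppset (A +: B) = oppset A +: oppset B.
Proof.
apply/fsetP => x; rewrite mem_oppset; apply/sumsetP/sumsetP => -[a aA [b bB e]].
  by exists (- a); rewrite ?mem_oppset ?opprK //; exists (- b);
    rewrite ?mem_oppset ?opprK // -opprD -e opprK.
by move: aA bB; rewrite !mem_oppset => aA bB; exists (- a) => //; exists (- b);
  rewrite // -opprD e.
Qed.

Lemma card_oppset A : #|` oppset A| = #|` A|.
Proof. exact/card_imfset/oppr_inj. Qed.

Lemma card_sumset_translate A a : #|` A +: [fset a]| = #|` A|.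
Proof.
have -> : A +: [fset a] = [fset x + a | x in A].
  apply/fsetP => x; apply/sumsetP/imfsetP => [[y yA [z]]|[y yA ->]].
    by rewrite inE => /eqP -> ->; exists y.
  by exists y => //; exists a; rewrite ?inE.
by rewrite card_imfset //=; apply: addIr.
Qed.

Lemma leq_card_sumset A B : B != fset0 -> (#|` A| <= #|` A +: B|)%N.
Proof.
case/fset0Pn => b bB; rewrite -(card_sumset_translate A b).
by apply/fsubset_leq_card/sumsetS => //; rewrite fsub1set.
Qed.

Lemma sumset0 A : A +: fset0 = fset0.
Proof.
by apply/fsetP => x; rewrite in_fset0; apply/sumsetP => -[y _ [z]];
  rewrite in_fset0.
Qed.

Lemma sumsetU1 A B a : A +: (a |` B) = (A +: B) `|` (A +: [fset a]).
Proof.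
apply/fsetP => x; rewrite in_fsetU; apply/sumsetP/orP => [[y yA [z]]|].
  rewrite in_fset1U => /orP[/eqP -> ->|zB ->]; last by left; exact: mem_sumset.
  by right; apply: mem_sumset; rewrite ?in_fset1.
case=> /sumsetP[y yA [z zB ->]]; exists y => //; exists z => //;
  by rewrite in_fset1U -?in_fset1 zB ?orbT.
Qed.

Lemma card_sumset_le A B : (#|` A +: B| <= #|` A| * #|` B|)%N.
Proof.
elim/fset1U_rect: B => [|b B bB IH]; first by rewrite sumset0 !cardfs0 muln0.
rewrite sumsetU1 cardfsU1 bB mulnDr muln1 addnC.
apply: leq_trans (leq_card_fsetU _ _) _.
by rewrite card_sumset_translate leq_add2r.
Qed.

Lemma sumset_0 A : A +: [fset 0] = A.
Proof.
apply/fsetP => x; apply/sumsetP/idP => [[y yA [z]]|xA].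
  by rewrite in_fset1 => /eqP -> ->; rewrite addr0.
by exists x => //; exists 0; rewrite ?in_fset1 ?addr0.
Qed.

(* Petridis: a subset minimizing the ratio |X + Y| / |X| works. *)
Lemma petridis A Y : A != fset0 ->
  exists X, [/\ X != fset0, X `<=` A &
    forall C, (#|` X +: Y +: C| * #|` A| <= #|` A +: Y| * #|` X +: C|)%N].
Proof.
move=> A0.
have [X [X0 XA ratX minX]] : exists X, [/\ X != fset0, X `<=` A,
    (#|` X +: Y| * #|` A| <= #|` A +: Y| * #|` X|)%N &
    forall Z, Z `<=` X -> (#|` X +: Y| * #|` Z| <= #|` Z +: Y| * #|` X|)%N].
  (* Strong induction on [A]: if [A] itself does not minimize the ratio, a subset [Z] of smaller
     ratio is proper and non-empty, and the claim for [Z] passes to [A]. *)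
  elim/finSet_rect: A A0 => A IH A0.
  have [minA|] := pselect (forall Z, Z `<=` A ->
    (#|` A +: Y| * #|` Z| <= #|` Z +: Y| * #|` A|)%N).
    by exists A; split.
  move=> /existsNP[Z] /not_implyP[ZA] /negP; rewrite -ltnNge => ltZ.
  have Z0 : Z != fset0.
    by apply: contraTneq ltZ => ->; rewrite cardfs0 muln0.
  have propZ : Z `<` A.
    rewrite fproperEneq ZA andbT.
    by apply: contraTneq ltZ => ->; rewrite ltnn.
  have [X [X0 XZ ratX minX]] := IH _ propZ Z0.
  exists X; split=> //; first exact: fsubset_trans ZA.
  move: Z0; rewrite -cardfs_gt0; nia.
exists X; split=> // C.
suff HC : (#|` X +: Y +: C| * #|` X| <= #|` X +: Y| * #|` X +: C|)%N.
  by move: X0; rewrite -cardfs_gt0; nia.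
elim/fset1U_rect: C => [|c C cC IH]; first by rewrite !sumset0 cardfs0.
rewrite !sumsetU1.
(* [Z] collects the x for which x + Y + c is already in X + Y + C. Adding c to [C] thus creates at
   most |X + Y| - |Z + Y| new elements of X + Y + C and at least |X| - |Z| new elements of X + C;
   minimality of the ratio of [X] compares the two. *)
pose Z := [fset x in X | [fset x] +: Y +: [fset c] `<=` X +: Y +: C].
have ZX : Z `<=` X by apply/fsubsetP => x; rewrite !inE => /andP[].
have cl : (#|` (X +: Y +: C) `|` (X +: Y +: [fset c])| + #|` Z +: Y| <=
           #|` X +: Y +: C| + #|` X +: Y|)%N.
  rewrite -(card_sumset_translate (X +: Y) c).
  rewrite -(card_sumset_translate (Z +: Y) c) -[leqRHS]cardfsUI leq_add2l.
  apply: fsubset_leq_card; rewrite fsubsetI.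
  apply/andP; split; last by rewrite !sumsetS.
  apply/fsubsetP => _ /sumsetP[_ /sumsetP[z zZ [y yY ->]] [c' c'C ->]].
  move: zZ; rewrite !inE /= => /andP[_ /fsubsetP]; apply.
  by rewrite !mem_sumset // in_fset1.
have cr : (#|` X +: C| + #|` X| <=
           #|` (X +: C) `|` (X +: [fset c])| + #|` Z|)%N.
  rewrite -(card_sumset_translate X c) -(card_sumset_translate Z c).
  rewrite -[leqLHS]cardfsUI leq_add2l.
  apply/fsubset_leq_card/fsubsetP => w; rewrite in_fsetI.
  move=> /andP[/sumsetP[x xX [d dC ->]] /sumsetP[z zX [c']]].
  rewrite in_fset1 => /eqP -> e; rewrite e mem_sumset ?in_fset1 //.
  rewrite !inE /= zX /=; apply/fsubsetP.
  move=> _ /sumsetP[_ /sumsetP[z' z'z [y yY ->]] [c'' c''c ->]].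
  move: z'z c''c; rewrite !in_fset1 => /eqP -> /eqP ->.
  by rewrite addrAC -e addrAC !mem_sumset.
have := minX _ ZX; nia.
Qed.

(** * Plunnecke-Ruzsa inequalities and Ruzsa covering *)

Section Plunnecke.
Variable F : realFieldType.

(** With [X] from [petridis], Y + C has a translate inside X + Y + C, while X + C lies in A + C.
    This lets a summand [Y] be exchanged for [A] at the cost of a factor [L]. *)
Lemma sumset_replace A Y (L : F) : A != fset0 ->
  #|` A +: Y|%:R <= L * #|` A|%:R ->
  forall C, #|` Y +: C|%:R <= L * #|` A +: C|%:R.
Proof.
move=> A0 HL C; have [X [X0 XA /(_ C)]] := petridis Y A0.
have a0 : 0 < #|` A|%:R :> F by rewrite ltr0n cardfs_gt0.
rewrite -(ler_nat F) !natrM => HX; rewrite -(ler_pM2r a0).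
have h1 : #|` Y +: C|%:R <= #|` X +: Y +: C|%:R :> F.
  by rewrite ler_nat -sumsetA (sumsetC X) leq_card_sumset.
have h2 : #|` X +: C|%:R <= #|` A +: C|%:R :> F.
  by rewrite ler_nat fsubset_leq_card ?sumsetS.
have h3 := ler0n F #|` X +: C|; have h4 := ler0n F #|` A +: Y|.
apply: le_trans (ler_pM _ _ h1 (lexx _)) _ => //.
apply: le_trans HX _; rewrite mulrAC; exact: ler_pM.
Qed.

(** The set [X] from [petridis] serves for every [C], so each further summand [Y] multiplies the
    size of X + Y + ... + Y by at most [L]. *)
Lemma sumset_iter A Y (L : F) n : A != fset0 ->
  #|` A +: Y|%:R <= L * #|` A|%:R ->
  #|` iter n.+1 (sumset Y) [fset 0]|%:R <= L ^+ n.+1 * #|` A|%:R.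
Proof.
move=> A0 HL; have [X [X0 XA HX]] := petridis Y A0.
have a0 : 0 < #|` A|%:R :> F by rewrite ltr0n cardfs_gt0.
have L0 : 0 <= L by rewrite -(pmulr_lge0 _ a0); apply: le_trans HL.
have step C : #|` X +: Y +: C|%:R <= L * #|` X +: C|%:R.
  rewrite -(ler_pM2r a0); have := HX C; rewrite -(ler_nat F) !natrM => h.
  by apply: le_trans h _; rewrite mulrAC ler_wpM2r.
suff h m : #|` X +: iter m (sumset Y) [fset 0]|%:R <= L ^+ m * #|` A|%:R.
  by apply: le_trans (h n.+1); rewrite ler_nat sumsetC leq_card_sumset.
elim: m => [|m IH] /=.
  by rewrite expr0 mul1r ler_nat card_sumset_translate fsubset_leq_card.
rewrite sumsetA; apply: le_trans (step _) _.
by rewrite exprS -mulrA ler_wpM2l.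
Qed.

(** The sum is 4A - 4A. Exchanging the four copies of [A] for -A costs L^4, and the eight-fold sum
    of -A costs L^8. *)
Lemma plunnecke A (L : F) : A != fset0 ->
  let B := A +: oppset A in
  #|` B|%:R <= L * #|` A|%:R ->
  #|` B +: B +: (B +: B)|%:R <= L ^+ 12 * #|` A|%:R.
Proof.
move=> A0 B HL.
have a0 : 0 < #|` A|%:R :> F by rewrite ltr0n cardfs_gt0.
have L0 : 0 <= L by rewrite -(pmulr_lge0 _ a0); apply: le_trans HL.
have := sumset_iter 7 A0 HL => /=.
set N := oppset A in B HL *.
have HN : #|` N +: A|%:R <= L * #|` N|%:R by rewrite sumsetC card_oppset.
have N0 : N != fset0 by rewrite -cardfs_gt0 card_oppset cardfs_gt0.
have rep := sumset_replace N0 HN.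
set N8 := (X in #|` X|) => H8.
have -> : B +: B +: (B +: B) = A +: (A +: (A +: (A +: (N +: (N +: (N +: N)))))).
  by rewrite /B (sumsetACA A N A N) (sumsetACA (A +: A)) -!sumsetA.
have H : #|` N +: (N +: (N +: (N +: (N +: (N +: (N +: N))))))|%:R
    <= L ^+ 8 * #|` A|%:R by apply: le_trans H8; rewrite /N8 /= sumset_0.
have mono x y : x <= y -> L * x <= L * y by apply: ler_wpM2l.
apply: le_trans (rep _) _; rewrite exprS -mulrA; apply: (mono).
do 3![rewrite !(sumsetCA N A); apply: le_trans (rep _) _;
  rewrite exprS -mulrA; apply: (mono)].
exact: H.
Qed.

(** [T] is a maximal subset of [Y] whose translates t + Z are disjoint, built greedily; the
    inequality |T| |Z| <= |T + Z| records the disjointness. *)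
Lemma ruzsa_covering Y Z : Z != fset0 ->
  exists T, Y `<=` T +: (Z +: oppset Z) /\ (#|` T| * #|` Z| <= #|` Y +: Z|)%N.
Proof.
move=> Z0.
suff [T [TY YT cT]] : exists T, [/\ T `<=` Y, Y `<=` T +: (Z +: oppset Z) &
    (#|` T| * #|` Z| <= #|` T +: Z|)%N].
  exists T; split=> //; apply: leq_trans cT _.
  by apply/fsubset_leq_card/sumsetS.
elim/fset1U_rect: Y => [|y Y yY [T [TY YT cT]]].
  by exists fset0; rewrite !fsub0set cardfs0.
have [yT|yT] := boolP (y \in T +: (Z +: oppset Z)).
  exists T; split=> //; first exact/fsubsetU/orP/(or_intror TY).
  by rewrite fsubUset fsub1set yT.
exists (y |` T); split; first by rewrite fsetUS.
  rewrite fsubUset fsub1set; apply/andP; split; last first.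
    by apply: fsubset_trans YT _; rewrite sumsetS ?fsubsetU1.
  case/fset0Pn: Z0 => z zZ; rewrite -[X in X \in _]addr0 -(subrr z).
  by rewrite !mem_sumset ?mem_oppset ?opprK ?fset1U1.
have yT' : y \notin T.
  by apply: contra yY => yT'; move/fsubsetP: TY => /(_ _ yT').
rewrite cardfsU1 yT' mulnDl mul1n addnC (sumsetC _ Z) sumsetU1 cardfsU.
rewrite card_sumset_translate (sumsetC Z T).
suff -> : (T +: Z) `&` (Z +: [fset y]) = fset0 by rewrite cardfs0 subn0 leq_add2r.
apply/fsetP => w; rewrite in_fset0 in_fsetI; apply: contraNF yT.
case/andP => /sumsetP[t tT [z zZ ->]] /sumsetP[z' z'Z [y']].
rewrite in_fset1 => /eqP -> e.
have -> : y = t + (z + - z') by apply: (addrI z'); rewrite -e [RHS]addrC addrA subrK.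
by rewrite !mem_sumset // mem_oppset opprK.
Qed.

End Plunnecke.
End Sumset.

Local Infix "+:" := sumset (at level 50, left associativity).

(** * Dilates and collisions *)

(** Cauchy-Schwarz for the fibre sizes [f], from 2 f(t) f(u) <= f(t)^2 + f(u)^2. *)
Lemma collision_count (Q T : finType) (g : Q -> T) :
  (#|Q| ^ 2 <= #|T| * #|[pred q : Q * Q | g q.1 == g q.2]|)%N.
Proof.
pose f t := #|[pred q | g q == t]|.
have -> : #|Q| = (\sum_t f t)%N.
  rewrite -sum1_card (partition_big g predT) //=.
  by apply: eq_bigr => t _; rewrite /f -sum1_card.
have -> : #|[pred q : Q * Q | g q.1 == g q.2]| = (\sum_t f t ^ 2)%N.
  rewrite -sum1_card (partition_big (fun q : Q * Q => g q.1) predT) //=.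
  apply: eq_bigr => t _; rewrite /f expnS expn1 -cardX -sum1_card.
  by apply: eq_bigl => -[q q']; rewrite !inE /=; apply/andP/andP => -[/eqP -> /eqP ->].
rewrite -(leq_pmul2l (isT : 0 < 2)%N) expnS expn1 big_distrlr /=.
have -> : (2 * (#|T| * \sum_t f t ^ 2) = \sum_t \sum_u (f t ^ 2 + f u ^ 2))%N.
  under [RHS]eq_bigr do rewrite big_split sum_nat_const /=.
  by rewrite big_split sum_nat_const /= -big_distrr /= mul2n -addnn.
rewrite big_distrr leq_sum //= => t _; rewrite big_distrr leq_sum //= => u _.
exact: nat_Cauchy.
Qed.

Section Rng.
Variable R : rngType.
Implicit Types (x y z d : R) (A B C : {fset R}).

Lemma rmulrN x y : x ** - y = - (x ** y).
Proof. by apply: (addrI (x ** y)); rewrite -rmulDr !subrr rmulr0. Qed.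

Lemma rmulNr x y : - x ** y = - (x ** y).
Proof. by apply: (addrI (x ** y)); rewrite -rmulDl !subrr rmul0r. Qed.

Lemma rmulBr x y z : x ** (y - z) = x ** y - x ** z.
Proof. by rewrite rmulDr rmulrN. Qed.

Lemma rmulBl x y z : (x - y) ** z = x ** z - y ** z.
Proof. by rewrite rmulDl rmulNr. Qed.

Lemma nonzerodiv_injl d : nonzerodiv d -> injective (rmul d).
Proof.
move=> nd x y e; apply/eqP; rewrite -subr_eq0.
by apply/negPn/negP => /nd[/negP]; rewrite rmulBr e subrr.
Qed.

Lemma nonzerodiv_injr d : nonzerodiv d -> injective (rmul^~ d).
Proof.
move=> nd x y e; apply/eqP; rewrite -subr_eq0.
by apply/negPn/negP => /nd[_ /negP]; rewrite rmulBl e subrr.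
Qed.

Lemma nonzerodivM x y : nonzerodiv x -> nonzerodiv y -> nonzerodiv (x ** y).
Proof.
move=> nx ny a a0; split.
  by rewrite -rmulA; case: (nx (y ** a)) => //; case: (ny a).
by rewrite rmulA; case: (ny (a ** x)) => //; case: (nx a).
Qed.

Definition mulset x A : {fset R} := [fset x ** a | a in A].

Lemma mem_mulset x y A : y \in A -> x ** y \in mulset x A.
Proof. by move=> yA; apply/imfsetP; exists y. Qed.

Lemma mulsetS x A B : A `<=` B -> mulset x A `<=` mulset x B.
Proof.
move=> /fsubsetP AB; apply/fsubsetP => _ /imfsetP[y /= yA ->].
exact/mem_mulset/AB.
Qed.

Lemma mulset_sum x A B : mulset x (A +: B) = mulset x A +: mulset x B.
Proof.
apply/fsetP => z; apply/imfsetP/sumsetP => [[_ /sumsetP[a aA [b bB ->]] ->]|].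
  by exists (x ** a); rewrite ?mem_mulset //; exists (x ** b);
    rewrite ?mem_mulset ?rmulDr.
case=> _ /imfsetP[a aA ->] [_ /imfsetP[b bB ->] ->].
by exists (a + b); rewrite ?rmulDr // mem_sumset.
Qed.

Lemma mulset_opp x A : mulset x (oppset A) = oppset (mulset x A).
Proof.
apply/fsetP => z; rewrite mem_oppset; apply/imfsetP/imfsetP => -[a /=].
  by rewrite mem_oppset => aA ->; exists (- a); rewrite // rmulrN.
by move=> aA e; exists (- a); rewrite ?mem_oppset /= ?opprK // rmulrN -e opprK.
Qed.

Lemma mulsetM x y A : mulset (x ** y) A = mulset x (mulset y A).
Proof.
apply/fsetP => z; apply/imfsetP/imfsetP => [[a aA ->]|[_ /imfsetP[a aA ->] ->]].
  by exists (y ** a); rewrite ?rmulA //= mem_mulset.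
by exists a; rewrite ?rmulA.
Qed.

Lemma mulset_subB x y A : mulset (x - y) A `<=` mulset x A +: oppset (mulset y A).
Proof.
apply/fsubsetP => _ /imfsetP[a /= aA ->]; rewrite rmulBl mem_sumset ?mem_mulset //.
by rewrite mem_oppset opprK mem_mulset.
Qed.

Lemma card_mulset_le x A : (#|` mulset x A| <= #|` A|)%N.
Proof. exact: leq_imfset_card. Qed.

Lemma card_mulset x A : nonzerodiv x -> #|` mulset x A| = #|` A|.
Proof. by move=> /nonzerodiv_injl/card_imfset ->. Qed.

Lemma mulset_eq0 x A : (mulset x A == fset0) = (A == fset0).
Proof.
apply/eqP/eqP => [A0|->]; last first.
  by apply/fsetP => z; rewrite in_fset0; apply/imfsetP => -[a]; rewrite in_fset0.
apply/fsetP => a; rewrite in_fset0; apply/negP => /(mem_mulset x).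
by rewrite A0.
Qed.

Lemma diffsetE A B : diffset A B = A +: oppset B.
Proof.
apply/fsetP => z; apply/imfset2P/sumsetP => -[a aA [b bB ->]]; exists a => //.
  by exists (- b); rewrite // mem_oppset opprK.
by exists (- b); rewrite -?mem_oppset ?opprK.
Qed.

Lemma mem_diffset A B x y : x \in A -> y \in B -> x - y \in diffset A B.
Proof. by move=> xA yB; apply: in_imfset2. Qed.

Definition zerodivs A : {fset R} := [fset x in A | ~~ `[< nonzerodiv x >]].

(** [q] is ((a, b), (a', b')). Cancellability of b - b' turns the collision into r (b - b') = p (a'
    - a), which determines [r]. *)
Definition good_collisions A p r : {pred (A * A) * (A * A)} :=
  [pred q | (p ** val q.1.1 + r ** val q.1.2 == p ** val q.2.1 + r ** val q.2.2)
          && `[< nonzerodiv (val q.1.2 - val q.2.2) >] ].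

Lemma good_collisions_count A p r : nonzerodiv p ->
  (#|` A| ^ 4 <= #|` mulset p A +: mulset r A| *
     (#|good_collisions (A := A) p r| +
      #|` A| ^ 2 * #|` zerodivs (diffset A A)|))%N.
Proof.
move=> np; set S := mulset p A +: mulset r A.
have memS (q : A * A) : p ** val q.1 + r ** val q.2 \in S.
  by rewrite mem_sumset // mem_mulset // fsvalP.
have := @collision_count _ _ (fun q => [` memS q]).
rewrite card_prod -!cardfE mulnn -expnM; set E := [pred _ | _].
move/leq_trans; apply; rewrite leq_mul2l; apply/orP; right.
pose D := [pred q : (A * A) * (A * A) |
  `[< nonzerodiv (val q.1.2 - val q.2.2) >] ].
rewrite -(cardID D E) leq_add //.
set Z := zerodivs _.
have memZ q : q \in [predD E & D] -> val q.1.2 - val q.2.2 \in Z.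
  by rewrite !inE => /andP[-> _]; rewrite mem_diffset ?fsvalP.
have [q0 q0E|/eq_card0 ->] := pickP [predD E & D]; last by [].
(* A discarded collision is recovered from (a', b') and b - b': these give b, hence p a, and [p]
   cancels. The collision [q0] supplies the default value that [insubd] requires. *)
pose h (q : (A * A) * (A * A)) : A * A * Z :=
  (q.2, insubd [` memZ _ q0E] (val q.1.2 - val q.2.2)).
have h_inj : {in [predD E & D] &, injective h}.
  move=> [[a b] [a' b']] [[c d] [c' d']] qE1 qE2 [e1 e2 /(congr1 val)].
  have /= m1 := memZ _ qE1; have /= m2 := memZ _ qE2.
  rewrite !val_insubd m1 m2 e2 => /addIr/val_inj e3.
  move: qE1 qE2; rewrite !inE -!(inj_eq val_inj) /= e1 e2 e3.
  by move=> /andP[_ /eqP <-] /andP[_ /eqP /addIr/(nonzerodiv_injl np)/val_inj ->].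
rewrite -(card_in_imset h_inj) (leq_trans (max_card _)) // !card_prod -!cardfE.
by rewrite mulnn.
Qed.
End Rng.

(** * Elements near a given one *)

Section Near.
Variables (F : realFieldType) (R : rngType) (A : {fset R}).
Hypothesis A_neq0 : A != fset0.
Implicit Types (p r s d : R) (L : F).

(* Plays the role of "r is homogeneous of the same degree as p". *)
Definition near L p r : Prop :=
  #|` mulset p A +: mulset r A|%:R <= L * #|` A|%:R.

Let A_gt0 : 0 < #|` A|%:R :> F.
Proof. by rewrite ltr0n cardfs_gt0. Qed.

(** After division by |A|, the discarded collisions contribute at most L |A|^2 |Z| <= |A|^3 / 2,
    where Z is the set of zero divisors in A - A; the good ones carry the other half. *)
Lemma near_good_collisions L p r : nonzerodiv p ->
  2 * L * #|` zerodivs (diffset A A)|%:R <= #|` A|%:R -> near L p r ->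
  #|` A|%:R ^+ 3 <= 2 * L * #|good_collisions (A := A) p r|%:R.
Proof.
move=> np Zsmall; have := A_gt0; have := good_collisions_count A r np.
rewrite /near -(ler_nat F) natrM natrX natrD natrM natrX.
set S := #|` _ +: _|%:R; set Z := #|` zerodivs _|%:R in Zsmall *.
set g := #|good_collisions _ _|%:R; set a := #|` A|%:R in Zsmall *.
move=> le4 a0 leS; have Z0 : 0 <= Z by []; have g0 : 0 <= g by [].
have le4' : a ^+ 4 <= L * a * (g + a ^+ 2 * Z).
  apply: le_trans le4 _; rewrite ler_wpM2r // addr_ge0 // mulr_ge0 //.
  by rewrite exprn_ge0 // ltW.
have le3 : a ^+ 3 <= L * (g + a ^+ 2 * Z).
  by rewrite -(ler_pM2r a0) -exprSr (le_trans le4') // mulrAC.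
have : 2 * L * Z * a ^+ 2 <= a * a ^+ 2 by rewrite ler_wpM2r // exprn_ge0 // ltW.
rewrite -exprS; lra.
Qed.

Lemma near_collision L p r : nonzerodiv p ->
  2 * L * #|` zerodivs (diffset A A)|%:R <= #|` A|%:R -> near L p r ->
  exists a b a' b', [/\ [/\ a \in A, b \in A, a' \in A & b' \in A],
    nonzerodiv (b - b') & r ** (b - b') = p ** (a' - a)].
Proof.
move=> np Zs /(near_good_collisions np Zs) le3.
have [[[a b] [a' b']]|/eq_card0 g0] := pickP (good_collisions (A := A) p r); last first.
  by move: le3; rewrite g0 mulr0 leNgt exprn_gt0.
rewrite /good_collisions /= => /andP[/eqP e /asboolP nb].
exists (val a), (val b), (val a'), (val b'); split=> //; first by split; apply: fsvalP.
by rewrite !rmulBr; apply/eqP; rewrite subr_eq addrAC -e addrAC subrr add0r.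
Qed.

(** Double counting: a quadruple is a good collision for at most one r, since b - b' cancels on the
    right. *)
Lemma sum_good_collisions p (X : {fset R}) :
  (\sum_(r : X) #|good_collisions (A := A) p (val r)| <= #|` A| ^ 4)%N.
Proof.
under eq_bigr => r _ do rewrite -sum1_card big_mkcond /=.
rewrite exchange_big /=.
have -> : (#|` A| ^ 4 = \sum_(q : (A * A) * (A * A)) 1)%N.
  by rewrite sum1_card !card_prod -!cardfE !mulnn -expnM.
apply: leq_sum => q _; rewrite -big_mkcond sum1_card.
apply/card_le1_eqP => r s; rewrite !unfold_in /= => /andP[/eqP er /asboolP nb].
move=> /andP[/eqP es _]; apply/val_inj/(nonzerodiv_injr nb) => /=.
have e t : p ** val q.1.1 + t ** val q.1.2 = p ** val q.2.1 + t ** val q.2.2 ->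
    t ** (val q.1.2 - val q.2.2) = p ** (val q.2.1 - val q.1.1).
  move=> h; rewrite !rmulBr; apply/eqP; rewrite subr_eq addrAC -h.
  by rewrite addrAC subrr add0r.
by rewrite !e.
Qed.

(** Each r in [X] has at least |A|^3 / (2L) good collisions, and all together they number at most
    |A|^4. *)
Lemma card_near L p (X : {fset R}) : nonzerodiv p -> 0 < L ->
  2 * L * #|` zerodivs (diffset A A)|%:R <= #|` A|%:R ->
  (forall r, r \in X -> near L p r) -> #|` X|%:R <= 2 * L * #|` A|%:R.
Proof.
move=> np L0 Zs Xnear; have a3 := exprn_gt0 3 A_gt0.
rewrite -(ler_pM2r a3) -(mulrA (2 * L)) -exprS cardfE.
apply: (@le_trans _ _
  (2 * L * (\sum_(r : X) #|good_collisions (A := A) p (val r)|)%:R)).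
  rewrite natr_sum mulr_sumr -sum1_card natr_sum mulr_suml.
  apply: ler_sum => r _; rewrite mul1r near_good_collisions //.
  exact/Xnear/fsvalP.
by rewrite ler_pM2l ?mulr_gt0 // -natrX ler_nat sum_good_collisions.
Qed.

(** * Nearness under differences and products *)

Variable M : F.
Let P := prodset A A.
Let B := diffset P P.
Hypothesis card_B4 : #|` B +: B +: (B +: B)|%:R <= M * #|` A|%:R.

Let mem_P x y : x \in A -> y \in A -> x ** y \in P.
Proof. exact: in_imfset2. Qed.

Let mulset_diff_sub x y : x \in A -> y \in A -> mulset (x - y) A `<=` B.
Proof.
move=> xA yA; apply/fsubsetP => _ /imfsetP[a /= aA ->].
by rewrite rmulBl mem_diffset // mem_P.
Qed.

Let B_neq0 : B != fset0.
Proof.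
case/fset0Pn: A_neq0 => a aA; apply/fset0Pn; exists (a ** a - a ** a).
by rewrite mem_diffset // mem_P.
Qed.

Let oppB : oppset B = B.
Proof. by rewrite /B diffsetE oppsetD oppsetK sumsetC. Qed.

Let card_subB2 (X : {fset R}) : X `<=` B +: B -> #|` X|%:R <= M * #|` A|%:R.
Proof.
move=> XB; apply: le_trans card_B4; rewrite ler_nat.
apply: leq_trans (fsubset_leq_card XB) _; apply: leq_card_sumset.
by case/fset0Pn: B_neq0 => b bB; apply/fset0Pn; exists (b + b); apply: mem_sumset.
Qed.

Let card_subB3 (X : {fset R}) : X `<=` B +: B +: B -> #|` X|%:R <= M * #|` A|%:R.
Proof.
move=> XB; apply: le_trans card_B4; rewrite ler_nat sumsetA.
by apply: leq_trans (fsubset_leq_card XB) _; apply: leq_card_sumset.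
Qed.

Variables u v : R.
Hypotheses (uA : u \in A) (vA : v \in A) (ne : nonzerodiv (u - v)).
Let e := u - v.

Lemma M_ge1 : 1 <= M.
Proof.
rewrite -(ler_pM2r A_gt0) mul1r -[X in X%:R <= _](card_mulset A ne); apply: card_subB2.
apply: fsubset_trans (mulset_diff_sub uA vA) _; apply/fsubsetP => b bB.
case/fset0Pn: A_neq0 => a aA.
by rewrite -[b]addr0 -(subrr (a ** a)) mem_sumset // mem_diffset // mem_P.
Qed.

(** With d = b - b' and W = dA - dA, Ruzsa covering puts [B] in T + W with |T| <= M. Since rd = pf
    for f = a' - a, the set pW + rW is p(dA - dA + fA - fA), inside p(B + B + B + B). The two copies
    of [T] and this set cost [M] each, independently of how near [r] was to [p]. *)
Lemma card_mulB_collision p r a b a' b' : nonzerodiv p ->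
  a \in A -> b \in A -> a' \in A -> b' \in A ->
  nonzerodiv (b - b') -> r ** (b - b') = p ** (a' - a) ->
  #|` mulset p B +: mulset r B|%:R <= M ^+ 3 * #|` A|%:R.
Proof.
move=> np aA bA a'A b'A nd erp; set d := b - b' in nd erp.
have M0 := le_trans ler01 M_ge1.
have dAB : mulset d A `<=` B by exact: mulset_diff_sub.
have fAB : mulset (a' - a) A `<=` B by exact: mulset_diff_sub.
have oppS X : X `<=` B -> oppset X `<=` B.
  move=> /fsubsetP XB; rewrite -oppB; apply/fsubsetP => x.
  by rewrite !mem_oppset; apply: XB.
have dA0 : mulset d A != fset0 by rewrite mulset_eq0.
have [T [BT cT]] := ruzsa_covering B dA0.
have {}cT : #|` T|%:R <= M.
  rewrite -(ler_pM2r A_gt0) -{1}(card_mulset A nd) -natrM.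
  apply: le_trans (card_subB2 (sumsetS (fsubset_refl B) dAB)).
  by rewrite ler_nat.
set W := mulset d A +: oppset (mulset d A) in BT.
have sub x : mulset x B `<=` mulset x T +: mulset x W.
  by rewrite -mulset_sum; apply: mulsetS.
have -> : M ^+ 3 * #|` A|%:R = (M * M) * (M * #|` A|%:R).
  by rewrite !exprS expr0 mulr1 !mulrA.
apply: (@le_trans _ _ ((#|` T| * #|` T|) * #|` B +: B +: (B +: B)|)%N%:R); last first.
  by rewrite !natrM; do !apply: ler_pM => //; rewrite -?natrM.
rewrite ler_nat.
apply: leq_trans (fsubset_leq_card (sumsetS (sub p) (sub r))) _.
rewrite sumsetACA; apply: leq_trans (card_sumset_le _ _) _; apply: leq_mul.
  by apply: leq_trans (card_sumset_le _ _) _; apply: leq_mul; apply: card_mulset_le.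
rewrite {2}/W mulset_sum mulset_opp -mulsetM erp mulsetM -mulset_opp -!mulset_sum.
rewrite card_mulset //; apply: fsubset_leq_card.
by rewrite /W !sumsetS // oppS.
Qed.

(** Right multiplication by the cancellable [e] sends pA + rA injectively into pB + rB, because Ae
    lies in [B]. *)
Lemma near_mulB p r L : #|` mulset p B +: mulset r B|%:R <= L * #|` A|%:R -> near L p r.
Proof.
apply: le_trans; rewrite ler_nat.
have <- : #|` [fset x ** e | x in mulset p A +: mulset r A]| =
    #|` mulset p A +: mulset r A| by exact/card_imfset/nonzerodiv_injr.
apply: fsubset_leq_card; apply/fsubsetP => _ /imfsetP[_ /sumsetP[x xA [y yA ->]] ->].
case/imfsetP: xA => a aA ->; case/imfsetP: yA => b bA ->.
have Ae c : c \in A -> c ** e \in B.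
  by move=> cA; rewrite rmulBr mem_diffset // mem_P.
by rewrite rmulDl -!rmulA mem_sumset // mem_mulset // Ae.
Qed.

(** Here eA lies in [B] and aA in a translate of [B], so peA + saA lies in a translate of pB +
    sB. *)
Lemma near_mul p s a L : a \in A ->
  #|` mulset p B +: mulset s B|%:R <= L * #|` A|%:R -> near L (p ** e) (s ** a).
Proof.
move=> aA; apply: le_trans; rewrite ler_nat.
case/fset0Pn: A_neq0 => a0 a0A.
rewrite -(card_sumset_translate (_ +: mulset s B) (s ** (a ** a0))).
apply: fsubset_leq_card; rewrite -sumsetA; apply: sumsetS.
  by rewrite mulsetM; apply/mulsetS/mulset_diff_sub.
apply/fsubsetP => _ /imfsetP[c /= cA ->].
have -> : s ** a ** c = s ** (a ** c - a ** a0) + s ** (a ** a0).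
  by rewrite rmulBr subrK rmulA.
by rewrite mem_sumset ?in_fset1 // mem_mulset // mem_diffset ?mem_P.
Qed.

Lemma near_pivot a : a \in A -> near M e a.
Proof.
move=> aA; case/fset0Pn: A_neq0 => a0 a0A.
rewrite /near -(card_sumset_translate _ (- (a ** a0))).
apply: card_subB2; rewrite -sumsetA; apply: sumsetS; first exact: mulset_diff_sub.
apply/fsubsetP => _ /sumsetP[_ /imfsetP[c cA ->] [y yE ->]].
by move: yE; rewrite in_fset1 => /eqP ->; rewrite mem_diffset ?mem_P.
Qed.

(** (r - s)A lies in rA - sA. Exchanging rA for pA and -sA for -pA costs M^3 each; the remaining p(A
    + A - A) has the size of e(A + A - A), a subset of B + B + B, and costs the last [M]. *)
Lemma near_sub p r s : nonzerodiv p -> near (M ^+ 3) p r -> near (M ^+ 3) p s ->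
  near (M ^+ 7) p (r - s).
Proof.
move=> np nr ns; have M0 := le_trans ler01 M_ge1.
have pA0 : mulset p A != fset0 by rewrite mulset_eq0.
have npA0 : oppset (mulset p A) != fset0.
  by rewrite -cardfs_gt0 card_oppset cardfs_gt0.
have repr : forall C, #|` mulset r A +: C|%:R <= M ^+ 3 * #|` mulset p A +: C|%:R.
  by apply: sumset_replace; rewrite // card_mulset.
have reps : forall C, #|` oppset (mulset s A) +: C|%:R <=
    M ^+ 3 * #|` oppset (mulset p A) +: C|%:R.
  by apply: sumset_replace; rewrite // -oppsetD !card_oppset card_mulset.
apply: (@le_trans _ _ #|` mulset p A +: (mulset r A +: oppset (mulset s A))|%:R).
  by rewrite ler_nat fsubset_leq_card // sumsetS // mulset_subB.
rewrite sumsetCA; apply: le_trans (repr _) _.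
rewrite -[M ^+ 7]/(M ^+ (3 + 4)) exprD -mulrA ler_wpM2l ?exprn_ge0 //.
rewrite sumsetA sumsetC; apply: le_trans (reps _) _.
rewrite (exprSr M 3) -mulrA ler_wpM2l ?exprn_ge0 //.
rewrite -mulset_opp -!mulset_sum card_mulset // -(card_mulset _ ne).
apply: card_subB3; rewrite !mulset_sum mulset_opp sumsetC.
have eB := mulset_diff_sub uA vA.
rewrite !sumsetS // -oppB; apply/fsubsetP => x.
by rewrite !mem_oppset; apply: (fsubsetP eB).
Qed.

Hypothesis zerodivs_small :
  2 * M ^+ 7 * #|` zerodivs (diffset A A)|%:R <= #|` A|%:R.

(** Self-improvement: nearness with M^7 yields a cancellable collision, which gives back the
    exponent 3. This keeps exponents from growing under repeated differences and products. *)
Lemma near_card_mulB p r : nonzerodiv p -> near (M ^+ 7) p r ->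
  #|` mulset p B +: mulset r B|%:R <= M ^+ 3 * #|` A|%:R.
Proof.
move=> np /(near_collision np zerodivs_small).
move=> [a [b [a' [b' [[aA bA a'A b'A] nd erp]]]]].
exact: card_mulB_collision erp.
Qed.

Lemma near_is_addsubgroup p : nonzerodiv p ->
  is_addsubgroup [set r | near (M ^+ 7) p r].
Proof.
move=> np; split=> [|r s /= nr ns].
  rewrite /= /near; have sub0 : mulset 0 A `<=` [fset 0].
    by apply/fsubsetP => _ /imfsetP[a _ ->]; rewrite rmul0r in_fset1.
  apply: (@le_trans _ _ (1 * #|` A|%:R)).
    rewrite mul1r ler_nat -(card_mulset A np) -[leqRHS](card_sumset_translate _ 0).
    by apply/fsubset_leq_card/sumsetS.
  by rewrite ler_wpM2r ?(ltW A_gt0) // exprn_ege1 // M_ge1.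
by apply: near_sub => //; apply/near_mulB/near_card_mulB.
Qed.

(** This is e^(n+1): with no unit available, the count starts at [e]. *)
Definition pivot n := iter n (rmul^~ e) e.

Lemma pivot_nonzerodiv n : nonzerodiv (pivot n).
Proof. by elim: n => //= n IH; apply: nonzerodivM. Qed.

Let weaken m p r : (m <= 7)%N -> near (M ^+ m) p r -> near (M ^+ 7) p r.
Proof.
move=> m7 h; apply: le_trans h _; rewrite ler_wpM2r ?(ltW A_gt0) //.
by apply: ler_weXn2l => //; apply: M_ge1.
Qed.

(** By induction the products in A^(n+1) are near e^(n+1), each new factor from [A] being matched by
    a factor [e]. The near elements form a subgroup, so the span follows. *)
Lemma addspan_near n r : addspan (prodpow A n.+1) r -> near (M ^+ 7) (pivot n) r.
Proof.
apply: (smallest_sub (near_is_addsubgroup (@pivot_nonzerodiv n))) r.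
elim: n => [|n IH] r /=.
  by move=> rA; apply: (@weaken 1) => //; rewrite expr1; apply: near_pivot.
move=> /imfset2P[s sA [a aA ->]]; apply: (@weaken 3) => //.
apply: near_mul => //; apply: near_card_mulB; first exact: pivot_nonzerodiv.
exact: IH.
Qed.

(** Stated for finite subsets [X], as the span is not yet known to be finite. *)
Lemma card_sub_addspan n (X : {fset R}) :
  (forall r, r \in X -> addspan (prodpow A n.+1) r) ->
  #|` X|%:R <= 2 * M ^+ 7 * #|` A|%:R.
Proof.
move=> Xs; apply: (@card_near _ (pivot n)) => //.
- exact: pivot_nonzerodiv.
- exact/exprn_gt0/(lt_le_trans ltr01)/M_ge1.
- by move=> r /Xs; apply: addspan_near.
Qed.

End Near.

(** * Graded families of bounded size *)

Section Powers.
Variables (R : rngType) (e : R).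
Hypothesis ne : nonzerodiv e.
Implicit Types (x y : R) (i j : nat).

(** [rpow j x] is x e^j and [lpow j x] is e^j x; iteration gives j = 0 a meaning without a unit. *)
Definition rpow j x := iter j (rmul^~ e) x.
Definition lpow j x := iter j (rmul e) x.

Lemma rpowD i j x : rpow (i + j) x = rpow i (rpow j x).
Proof. exact: iterD. Qed.

Lemma rpowC i j x : rpow i (rpow j x) = rpow j (rpow i x).
Proof. by rewrite -!rpowD addnC. Qed.

Lemma lpowD i j x : lpow (i + j) x = lpow i (lpow j x).
Proof. exact: iterD. Qed.

Lemma lpowSr j x : lpow j.+1 x = lpow j (e ** x).
Proof. exact: iterSr. Qed.

Lemma rpow_inj j : injective (rpow j).
Proof. by elim: j => [|j IH] x y //= /(nonzerodiv_injr ne)/IH. Qed.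

Lemma lrpow i j x : lpow i (rpow j x) = rpow j (lpow i x).
Proof.
elim: i => //= i ->; rewrite /rpow.
by elim: j (lpow i x) => //= j IH y; rewrite rmulA IH.
Qed.

Lemma rpowM j x y : rpow j (x ** y) = x ** rpow j y.
Proof. by elim: j => //= j ->; rewrite rmulA. Qed.

Lemma lpowM j x y : lpow j (x ** y) = lpow j x ** y.
Proof. by elim: j => //= j ->; rewrite rmulA. Qed.

Lemma rmul_rpow j x y : rpow j x ** y = x ** lpow j y.
Proof. by elim: j y => //= j IH y; rewrite -rmulA IH -lpowSr. Qed.

Lemma rpow_add j x y : rpow j (x + y) = rpow j x + rpow j y.
Proof. by elim: j => //= j ->; rewrite rmulDl. Qed.
End Powers.

Section GradedModel.
Variables (R : rngType) (H : nat -> {fset R}) (e : R) (N0 : nat).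
Hypothesis H_zero : forall n, (0 < n)%N -> 0 \in H n.
Hypothesis H_sub : forall n, (0 < n)%N -> {in H n &, forall x y, x - y \in H n}.
Hypothesis H_mul : forall n m, (0 < n)%N -> (0 < m)%N ->
  forall x y, x \in H n -> y \in H m -> x ** y \in H (n + m).
Hypotheses (eH : e \in H 1) (ne : nonzerodiv e).
Hypothesis cardH : forall n, (0 < n)%N -> (#|` H n| <= N0)%N.
Local Notation rpow := (rpow e).
Local Notation lpow := (lpow e).

Lemma rpow_mem n j x : (0 < n)%N -> x \in H n -> rpow j x \in H (n + j).
Proof.
move=> n0 xH; elim: j => [|j IH]; rewrite ?addn0 //= addnS -addn1.
by apply: H_mul => //; rewrite addn_gt0 n0.
Qed.

Lemma rpow_imfset n j : (0 < n)%N -> [fset rpow j x | x in H n] `<=` H (n + j).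
Proof.
by move=> n0; apply/fsubsetP => _ /imfsetP[x /= xH ->]; apply: rpow_mem.
Qed.

Lemma card_rpow n j : #|` [fset rpow j x | x in H n]| = #|` H n|.
Proof. exact/card_imfset/rpow_inj. Qed.

(** Right multiplication by [e] embeds H n in H (n + 1), so the sizes do not decrease; being bounded
    by [N0], they reach a maximum at some [n0], from which on the embeddings are onto. *)
Lemma rpow_stable : exists2 n0, (0 < n0)%N & forall n j y, (n0 <= n)%N ->
  y \in H (n + j) -> exists2 x, x \in H n & rpow j x = y.
Proof.
pose P k := `[< exists2 n, (0 < n)%N & #|` H n| = k >].
have exP : exists k, P k by exists #|` H 1|; apply/asboolP; exists 1%N.
have leP k : P k -> (k <= N0)%N by move=> /asboolP[n /cardH le <-].
case: (ex_maxnP exP leP) => k /asboolP[n0 n0_gt0 <-] maxn0.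
exists n0 => // n j y n0n yH; have n_gt0 : (0 < n)%N by apply: leq_trans n0n.
suff E : [fset rpow j x | x in H n] = H (n + j).
  by move: yH; rewrite -E => /imfsetP[x xH ->]; exists x.
apply/eqP; rewrite eqEfcard rpow_imfset //= card_rpow.
apply: leq_trans (maxn0 _ _) _.
  by apply/asboolP; exists (n + j)%N; rewrite // addn_gt0 n_gt0.
rewrite -(card_rpow n0 (n - n0)) -[in leqRHS](subnKC n0n).
exact/fsubset_leq_card/rpow_imfset.
Qed.

(** Conjugation x -> e x e^-1 is a permutation [s] of the finite set H n0; if [k] is its order, e^k
    commutes with H n0. *)
Lemma shift_commute : exists2 N, (0 < N)%N &
  (forall j y, y \in H (N + j) -> exists2 x, x \in H N & rpow j x = y) /\
  (forall n x, (0 < n)%N -> x \in H n -> lpow N x = rpow N x).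
Proof.
have [n0 n0_gt0 surj] := rpow_stable.
have ex_conj (x : H n0) : exists y : H n0, rpow 1 (val y) == lpow 1 (val x).
  have [|y yH <-] := surj n0 1%N (lpow 1 (val x)) (leqnn _).
    by rewrite addnC; apply: H_mul => //; apply: fsvalP.
  by exists [` yH].
pose f x := xchoose (ex_conj x).
have fE x : rpow 1 (val (f x)) = lpow 1 (val x) by exact/eqP/(xchooseP (ex_conj x)).
have f_inj : injective f.
  by move=> x y fxy; apply/val_inj/(nonzerodiv_injl ne); rewrite -[LHS]fE fxy fE.
pose s := perm f_inj; pose k := #[s]%g.
have sE j (x : H n0) : rpow j (val ((s ^+ j)%g x)) = lpow j (val x).
  elim: j => [|j IH]; first by rewrite expg0 perm1.
  rewrite expgSr permM permE -addn1 rpowD fE -lrpow IH -lpowD.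
  by rewrite addnC.
have com j x : x \in H n0 -> lpow (j * k) x = rpow (j * k) x.
  move=> xH; elim: j => // j IH; rewrite mulSn lpowD rpowD IH lrpow rpowC.
  by congr (rpow _ _); have := sE k [` xH]; rewrite /k expg_order perm1.
(* A multiple of [k] for commutation, at least [n0] for surjectivity. *)
exists (n0 * k)%N; first by rewrite muln_gt0 n0_gt0 order_gt0.
split=> [j y|n x n_gt0 xH].
  by apply: surj; rewrite leq_pmulr // order_gt0.
(* For x in H n, the element x e^n0 is y e^n with y in H n0, so e^N commutes with it, and e^n0
   cancels. *)
apply: (@rpow_inj _ _ ne n0); rewrite -lrpow rpowC.
have := rpow_mem n0 n_gt0 xH; rewrite addnC => /surj[] // y yH <-.
by rewrite lrpow com // rpowC.
Qed.

(** * The ring of fractions, its automorphism and the embeddings *)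

Section Model.
Variable N : nat.
Hypothesis N_gt0 : (0 < N)%N.
Hypothesis surj : forall j y, y \in H (N + j) ->
  exists2 x, x \in H N & rpow j x = y.
Hypothesis shiftE : forall n x, (0 < n)%N -> x \in H n -> lpow N x = rpow N x.
Local Notation G := (H N).

(* y e^-j as an element of H N; junk if there is none. *)
Definition unshift j y : R := xget 0 [set x | x \in G /\ rpow j x = y]%classic.

Lemma unshiftP j y : y \in H (N + j) ->
  unshift j y \in G /\ rpow j (unshift j y) = y.
Proof.
move=> /surj[x xG xy]; rewrite /unshift.
by case: xgetP => [z -> //|/(_ x)[]].
Qed.

Let oppG (x : G) : - val x \in G.
Proof. by rewrite -[X in X \in _]sub0r H_sub ?H_zero ?fsvalP. Qed.

Let addG (x y : G) : val x + val y \in G.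
Proof. by rewrite -[val y]opprK H_sub ?fsvalP ?oppG. Qed.

Let mulG (x y : G) : unshift N (val x ** val y) \in G /\
  rpow N (unshift N (val x ** val y)) = val x ** val y.
Proof. by apply/unshiftP/H_mul => //; apply: fsvalP. Qed.

Let zeroT : G := [` H_zero N_gt0].
Let oppT (x : G) : G := [` oppG x].
Let addT (x y : G) : G := [` addG x y].
(** An element x of [G] stands for the fraction x e^-N. Since e^N commutes with every H n, n > 0,
    the product of the fractions of x and y is (x y e^-N) e^-N. *)
Let mulT (x y : G) : G := [` (mulG x y).1].

Let addTA : associative addT.
Proof. by move=> x y z; apply/val_inj/addrA. Qed.
Let addTC : commutative addT.
Proof. by move=> x y; apply/val_inj/addrC. Qed.
Let addT0 : left_id zeroT addT.
Proof. by move=> x; apply/val_inj/add0r. Qed.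
Let addTN : left_inverse zeroT oppT addT.
Proof. by move=> x; apply/val_inj/addNr. Qed.

Definition modelZ : zmodType :=
  HB.pack (fset_sub_type G)
    (GRing.isZmodule.Build (fset_sub_type G) addTA addTC addT0 addTN).

Let shift_inj x y : rpow N (val x) = rpow N (val y) -> x = y :> modelZ.
Proof. by move=> /rpow_inj e1; apply/val_inj/e1. Qed.

Let mulTA : associative (mulT : modelZ -> modelZ -> modelZ).
Proof.
move=> x y z; apply/shift_inj/(@rpow_inj _ _ ne N).
rewrite (mulG x (mulT y z)).2 (mulG (mulT x y) z).2.
(* [shiftE] moves e^N from the right of z to its left, where it clears the denominator in the
   product of x and y. *)
rewrite rpowM (mulG y z).2 rpowM -(shiftE N_gt0 (fsvalP z)) -rmul_rpow.
by rewrite (mulG x y).2 rmulA.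
Qed.

Let mulTDl : left_distributive (mulT : modelZ -> modelZ -> modelZ) +%R.
Proof.
move=> x y z; apply/shift_inj; rewrite (mulG (addT x y) z).2 rpow_add.
by rewrite (mulG x z).2 (mulG y z).2 rmulDl.
Qed.

Let mulTDr : right_distributive (mulT : modelZ -> modelZ -> modelZ) +%R.
Proof.
move=> x y z; apply/shift_inj; rewrite (mulG x (addT y z)).2 rpow_add.
by rewrite (mulG x y).2 (mulG x z).2 rmulDr.
Qed.

Definition modelR : finRngType :=
  HB.pack (fset_sub_type G) (GRing.Zmodule.class modelZ)
    (Zmodule_isRng.Build modelZ mulTA mulTDl mulTDr).

Let conjG (x : G) : unshift 1 (e ** val x) \in G /\
  rpow 1 (unshift 1 (e ** val x)) = e ** val x.
Proof. by apply: unshiftP; rewrite addnC; apply: H_mul => //; apply: fsvalP. Qed.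

(** The representative e x e^-1; on fractions this is conjugation by [e], as [e] commutes with
    e^-N. *)
Let conjT (x : modelR) : modelR := [` (conjG x).1].

Let conjT_D : {morph conjT : x y / x + y}.
Proof.
move=> x y; apply/val_inj/(@rpow_inj _ _ ne 1); rewrite (conjG (addT x y)).2.
by rewrite [RHS]rpow_add (conjG x).2 (conjG y).2 rmulDr.
Qed.

Let conjT_M : {morph conjT : x y / x ** y}.
Proof.
move=> x y; apply/shift_inj/(@rpow_inj _ _ ne 1).
rewrite rpowC (conjG (mulT x y)).2 -[e ** _]/(lpow 1 _) -lrpow (mulG x y).2.
rewrite (mulG (conjT x) (conjT y)).2 lpowM rpowM (conjG y).2.
by rewrite -[e ** val y]/(lpow 1 _) -rmul_rpow (conjG x).2.
Qed.

Let conjT_bij : bijective conjT.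
Proof.
apply: injF_bij => x y xy; apply/val_inj/(nonzerodiv_injl ne).
by rewrite -[LHS](conjG x).2 -[RHS](conjG y).2 -[unshift _ _]/(val (conjT x)) xy.
Qed.

Definition model_aut : rngAut modelR := RngAut conjT_D conjT_M conjT_bij.

(** The relation t^j a = phi^j(a) t^j, with e^j in place of t^j. *)
Lemma iter_model_aut j (x : modelR) :
  rpow j (val (iter j model_aut x)) = lpow j (val x).
Proof.
elim: j => // j IH; rewrite -addn1 rpowD addn1 iterS.
by rewrite (conjG (iter j model_aut x)).2 -[e ** _]/(lpow 1 _) -lrpow IH.
Qed.

(* [g] in [H n] is sent to [(g e^-n) t^n], where [g e^-n] is represented by the
   element [g e^(N-n)] of [H N]. *)
Definition model_coef n (g : R) : modelR := insubd zeroT (unshift n (rpow N g)).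

Lemma model_coefE n g : (0 < n)%N -> g \in H n ->
  rpow n (val (model_coef n g)) = rpow N g.
Proof.
move=> n_gt0 gH; have [] := @unshiftP n (rpow N g).
  by rewrite addnC rpow_mem.
by move=> uG <-; rewrite /model_coef val_insubd uG.
Qed.

Definition model_emb n g : twpoly model_aut := twmono model_aut (model_coef n g) n.

Lemma model_emb_inj n : (0 < n)%N -> {in H n &, injective (model_emb n)}.
Proof.
move=> n_gt0 g h gH hH /(congr1 (mcoeff n)); rewrite !mcoeffUU => gh.
apply: (@rpow_inj _ _ ne N).
by rewrite -(model_coefE n_gt0 gH) gh model_coefE.
Qed.

Lemma model_embD n : (0 < n)%N -> {in H n &, {morph model_emb n : g h / g + h}}.
Proof.
move=> n_gt0 g h gH hH; rewrite /model_emb -twmonoD; congr twmono.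
have ghH : g + h \in H n.
  by rewrite -[h]opprK H_sub // -sub0r H_sub ?H_zero.
apply/val_inj/(@rpow_inj _ _ ne n); rewrite model_coefE //.
by rewrite [RHS]rpow_add !model_coefE // rpow_add.
Qed.

(** In fractions, (g e^-n) e^n (h e^-m) e^-n = g h e^-(n+m). Both sides are compared after
    multiplication by e^(N+n+m), which clears the denominators. *)
Lemma model_embM n m g h : (0 < n)%N -> (0 < m)%N -> g \in H n -> h \in H m ->
  model_emb n g ** model_emb m h = model_emb (n + m) (g ** h).
Proof.
move=> n_gt0 m_gt0 gH hH; rewrite [LHS]twmulUU; congr twmono.
set z := model_coef n g; set w := model_coef m h.
apply/shift_inj/(@rpow_inj _ _ ne (n + m)).
rewrite (mulG z (iter n model_aut w)).2 [RHS]rpowC model_coefE; last exact: H_mul.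
  rewrite [(n + m)%N]addnC rpowD rpowM iter_model_aut -rmul_rpow.
  by rewrite model_coefE // rpowM model_coefE // rmul_rpow lrpow
    (shiftE m_gt0 hH) !rpowM.
by rewrite addn_gt0 n_gt0.
Qed.
End Model.

Lemma graded_model : exists (R0 : finRngType) (phi : rngAut R0)
    (iota : nat -> R -> twpoly phi),
  [/\ (#|` H 1| <= #|R0|)%N, exists2 n, (0 < n)%N & #|R0| = #|` H n|,
    forall n, (0 < n)%N -> [/\ forall g, twdeg phi n (iota n g),
      {in H n &, injective (iota n)} & {in H n &, {morph iota n : g h / g + h}}] &
    forall n m, (0 < n)%N -> (0 < m)%N -> forall g h, g \in H n -> h \in H m ->
      iota n g ** iota m h = iota (n + m)%N (g ** h)].
Proof.
have [N N_gt0 [surj shiftE]] := shift_commute.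
have cardR0 : #|modelR N_gt0 surj shiftE| = #|` H N| by rewrite cardfE.
exists (modelR N_gt0 surj shiftE), (model_aut N_gt0 surj shiftE).
exists (model_emb N_gt0 surj shiftE); split.
- rewrite cardR0 -(card_rpow 1 N.-1) -[in leqRHS](prednK N_gt0) -add1n.
  exact/fsubset_leq_card/rpow_imfset.
- by exists N.
- move=> n n_gt0; split=> [g||]; first by eexists.
    exact: model_emb_inj.
  exact: model_embD.
- by move=> n m n_gt0 m_gt0 g h gH hH; apply: model_embM.
Qed.
End GradedModel.

(** * Spans of product sets *)

Section Addspan.
Variable R : rngType.
Implicit Types (A X Y : {fset R}).

Lemma addspan_is_addsubgroup X : is_addsubgroup (addspan X).
Proof.
split=> [G [[]]//|x y xX yX G GX]; apply: GX.1.2; [exact: xX|exact: yX].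
Qed.

Lemma mem_addspan X x : x \in X -> addspan X x.
Proof. by move=> xX G [_]; apply. Qed.

(** Minimality of the span is used in each variable in turn: the x with x y in the span of [Z] form
    a subgroup, and for fixed a in [X] so do the y with a y in it. *)
Lemma addspanM X Y Z x y : {in X & Y, forall a b, a ** b \in Z} ->
  addspan X x -> addspan Y y -> addspan Z (x ** y).
Proof.
move=> XYZ xX yY; have [Z0 ZB] := addspan_is_addsubgroup Z.
apply: (xX [set x | addspan Z (x ** y)]%classic); split=> [|a /= aX].
  by split=> [|a b /= aZ bZ]; [rewrite /= rmul0r | rewrite rmulBl; apply: ZB].
apply: (yY [set y | addspan Z (a ** y)]%classic); split=> [|b /= bY].
  by split=> [|b c /= bZ cZ]; [rewrite /= rmulr0 | rewrite rmulBr; apply: ZB].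
by apply: mem_addspan; apply: XYZ.
Qed.

Lemma prodpowM A n m : {in prodpow A n.+1 & prodpow A m.+1,
  forall x y, x ** y \in prodpow A (n.+1 + m.+1)}.
Proof.
elim: m => [|m IH] x y xA; rewrite addnS.
  by move=> yA; rewrite addn0; apply: in_imfset2.
move=> /imfset2P[z zA [a aA ->]]; rewrite rmulA; apply: in_imfset2 => //.
exact: IH.
Qed.

(** For fixed v in [A], the |A| differences a - v lie in A - A; they are too many to be all zero
    divisors. *)
Lemma zerodivs_small_nonzerodiv A :
  (#|` zerodivs (diffset A A)| < #|` A|)%N -> A != fset0 ->
  exists u v, [/\ u \in A, v \in A & nonzerodiv (u - v)].
Proof.
move=> ltA /fset0Pn[v vA]; apply: contrapT => noA; move: ltA; apply/negP.
rewrite -leqNgt.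
have <- : #|` [fset a - v | a in A]| = #|` A| by exact/card_imfset/addIr.
apply/fsubset_leq_card/fsubsetP => _ /imfsetP[u /= uA ->].
rewrite !inE /= mem_diffset //=; apply/asboolPn => nz.
by apply: noA; exists u, v.
Qed.

End Addspan.

Lemma finite_addspan (F : realType) (R : rngType) (S : set R) (L : F) :
  (forall X : {fset R}, (forall x, x \in X -> S x) -> #|` X|%:R <= L) ->
  finite_set S.
Proof.
move=> cS; apply: contrapT => /(@infinite_set_fset _ _ (Num.bound L))[X XS].
rewrite leqNgt -(ltr_nat F); apply/negP/negPn.
have L0 : 0 <= L by apply: le_trans (cS fset0 _).
exact: le_lt_trans (cS X XS) (archi_boundP L0).
Qed.

Theorem theorem1p6 (F : realType) :
  exists2 C : F, 0 < C &
  forall (R : rngType) (A : {fset R}) (K : F),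
    A != fset0 -> 1 <= K ->
    #|` diffset (prodset A A) (prodset A A)|%:R <= K * #|` A|%:R ->
    #|` A|%:R / K <= #|` prodset A A|%:R ->
    C^-1 * K `^ (- C) * #|` A|%:R
      <= #|` [fset x in diffset A A | ~~ `[< nonzerodiv x >]]|%:R
    \/
    exists (R0 : finRngType) (phi : rngAut R0)
           (iota : nat -> R -> twpoly phi),
      [/\ #|` A|%:R <= #|R0|%:R :> F,
          #|R0|%:R <= C * K `^ C * #|` A|%:R,
          forall n, (1 <= n)%N ->
            [/\ forall g, addspan (prodpow A n) g -> twdeg phi n (iota n g),
                {in addspan (prodpow A n) &, injective (iota n)} &
                {in addspan (prodpow A n) &,
                  {morph iota n : g h / g + h}}] &
          forall n m, (1 <= n)%N -> (1 <= m)%N ->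
            forall gn gm, addspan (prodpow A n) gn -> addspan (prodpow A m) gm ->
              iota n gn ** iota m gm = iota (n + m)%N (gn ** gm)].
Proof.
(* 175 = 7 * 25: the sumset bound is M = K^25, and nearness uses M^7. The factor 175 also absorbs
   the 2 in the smallness of the zero divisors and in the size of H n. *)
exists 175%:R => // R A K A0 K1 hD hP.
have K0 : 0 < K by apply: lt_le_trans K1.
rewrite powRN !powR_mulrn ?(ltW K0) //.
rewrite -/(zerodivs (diffset A A)).
set Z := zerodivs _; set q := K ^+ 175.
have q1 : 1 <= q by apply: exprn_ege1.
have a0 : 0 < #|` A|%:R :> F by rewrite ltr0n cardfs_gt0.
have [|Zlt] := leP (175%:R^-1 * q^-1 * #|` A|%:R) #|` Z|%:R; [by left|right].
have q0 : 0 < q by apply: lt_le_trans q1.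
have Zsmall : 2 * q * #|` Z|%:R <= #|` A|%:R.
  move: Zlt; rewrite -invfM mulrC ltr_pdivlMr ?mulr_gt0 // => /ltW.
  apply: le_trans; rewrite [leRHS]mulrC !ler_wpM2r ?ler_nat //; exact: ltW.
set P := prodset A A in hD hP.
have P0 : P != fset0.
  by case/fset0Pn: A0 => a aA; apply/fset0Pn; exists (a ** a); apply: in_imfset2.
have cardP : #|` P|%:R <= K * #|` A|%:R.
  apply: le_trans hD; rewrite ler_nat diffsetE leq_card_sumset //.
  by rewrite -cardfs_gt0 card_oppset cardfs_gt0.
(* Since |P - P| <= K |A| <= K^2 |P|, [plunnecke] applies to [P] with L = K^2 and gives K^24 |P| <=
   K^25 |A|. *)
pose M := K ^+ 25; have M7 : M ^+ 7 = q by rewrite -exprM.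
have card_B4 : #|` diffset P P +: diffset P P +: (diffset P P +: diffset P P)|%:R
    <= M * #|` A|%:R.
  rewrite diffsetE; apply: le_trans (plunnecke (L := K ^+ 2) P0 _) _.
    rewrite -diffsetE; apply: le_trans hD _; rewrite expr2 -mulrA ler_pM2l //.
    by rewrite mulrC -ler_pdivrMr.
  by rewrite -exprM /M exprSr -mulrA ler_pM2l // exprn_gt0.
have [u [v [uA vA nz]]] : exists u v, [/\ u \in A, v \in A & nonzerodiv (u - v)].
  apply: zerodivs_small_nonzerodiv A0; rewrite -(ltr_nat F) -/Z.
  have : #|` Z|%:R <= q * #|` Z|%:R by rewrite ler_peMl.
  move: Zsmall a0; rewrite -mulrA; set qZ := q * _; lra.
have cardS n (X : {fset R}) : (forall r, r \in X -> addspan (prodpow A n.+1) r) ->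
    #|` X|%:R <= 2 * q * #|` A|%:R.
  by rewrite -M7; apply: (card_sub_addspan A0 card_B4 uA vA nz); rewrite M7.
(* [fset_set] returns the empty set on infinite sets, so [H n] is known to be the span only through
   [finS]. *)
pose H n := fset_set (addspan (prodpow A n)).
have finS n : (0 < n)%N -> finite_set (addspan (prodpow A n)).
  by case: n => // n _; apply: finite_addspan (cardS n).
have memH n g : (0 < n)%N -> (g \in H n) = (g \in addspan (prodpow A n)).
  by move=> /finS fS; rewrite in_fset_set.
have memHP n g : (0 < n)%N -> g \in H n <-> addspan (prodpow A n) g.
  by move=> n0; rewrite memH // in_setE.
have cardH n : (0 < n)%N -> #|` H n|%:R <= 2 * q * #|` A|%:R.
  by case: n => // n _; apply: (cardS n) => r /memHP; apply.
have H1 x : x \in A -> x \in H 1 by move=> xA; apply/memHP => //; apply: mem_addspan.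
have L0 : 0 <= 2 * q * #|` A|%:R by rewrite !mulr_ge0 // ltW.
have HB n : (0 < n)%N -> {in H n &, forall x y, x - y \in H n}.
  move=> n0 x y /memHP xH /memHP yH; apply/memHP => //.
  by apply: (addspan_is_addsubgroup _).2; [apply: xH | apply: yH].
have [||n m|||n|R0 [phi [iota [cA [N N0 cR0] iotaE iotaM]]]] :=
  @graded_model R H (u - v) (Num.bound (2 * q * #|` A|%:R)).
- by move=> n n0; apply/memHP => //; apply: (addspan_is_addsubgroup _).1.
- exact: HB.
- case: n m => [|n] [|m] // _ _ x y /memHP xH /memHP yH; apply/memHP => //.
  by apply: addspanM (xH _) (yH _) => //; apply: prodpowM.
- by apply: HB => //; apply: H1.
- exact: nz.
- move=> n0; rewrite -(ler_nat F); apply/ltW/(le_lt_trans (cardH n n0)).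
  exact: archi_boundP.
exists R0, phi, iota; split.
- rewrite ler_nat; apply: leq_trans cA; exact/fsubset_leq_card/fsubsetP.
- rewrite cR0; apply: le_trans (cardH _ N0) _.
  by rewrite ler_pM2r // ler_pM2r // ler_nat.
- move=> n n0; have [deg inj morphD] := iotaE n n0; split=> [g _||] //.
    by move=> g h gA hA; apply: inj; rewrite memH.
  by move=> g h gA hA; apply: morphD; rewrite memH.
- by move=> n m n0 m0 g h gA hA; apply: iotaM => //; apply/memHP.
Qed.
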